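(* For all integers $n>1$, $c\ge1$ and $0\le k\le (c-1)n+c\binom{n}{2}$, we have $i_c(n,k)=i_c(n,k-1)+i_c(n-1,k)-i_c(n-1,k-cn)$.
   Context: For integers $n\ge1$, $c\ge1$, let $G_{c,n}$ be the set of colored permutations: words $\sigma=\sigma_1^{[c_1]}\cdots\sigma_n^{[c_n]}$ where $|\sigma|=\sigma_1\cdots\sigma_n$ is a permutation of $[n]$ and each color $c_i\in\{0,\dots,c-1\}$. For a permutation $\pi$ of $[n]$, $\mathrm{inv}(\pi)=|\{(i,j):i<j,\ \pi_i>\pi_j\}|$. Let $\mathrm{col}(\sigma)=c_1+\cdots+c_n$ and $\mathrm{inv}_c(\sigma)=\mathrm{inv}(|\sigma|)+\mathrm{col}(\sigma)+c\cdot|\{(i,j):1\le i<j\le n,\ \sigma_i<\sigma_j,\ c_j\ne0\}|$. Define $i_c(n,k)=|\{\sigma\in G_{c,n}:\mathrm{inv}_c(\sigma)=k\}|$ for all integers $k$ (so $i_c(n,k)=0$ for $k<0$). *)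

(* Defs.v *)
From mathcomp Require Import all_boot all_order all_algebra all_fingroup.

Set Implicit Arguments.
Unset Strict Implicit.
Unset Printing Implicit Defensive.

(* A colored permutation is stored as the pair of its underlying permutation
   and its color vector; positions and letters are 0-based ('I_n = {0..n-1}
   instead of [n]), which does not affect any of the comparisons below. *)
Notation colored_perm c n := ('S_n * {ffun 'I_n -> 'I_c})%type.

Definition inv (n : nat) (p : 'S_n) : nat :=
  #|[set ij : 'I_n * 'I_n | (ij.1 < ij.2) && (p ij.2 < p ij.1)]|.

Definition col (c n : nat) (s : colored_perm c n) : nat := \sum_(i < n) s.2 i.

Definition inv_c (c n : nat) (s : colored_perm c n) : nat :=
  inv s.1 + col s +
  c * #|[set ij : 'I_n * 'I_n |
          [&& ij.1 < ij.2, s.1 ij.1 < s.1 ij.2 & s.2 ij.2 != 0 :> nat]]|.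

(* The argument k is an integer, so that i_c c n k = 0 for k < 0. *)
Definition i_c (c n : nat) (k : int) : nat :=
  #|[set s : colored_perm c n | Posz (inv_c s) == k]|.

(* Main.v *)
Require Import Defs.
From mathcomp Require Import all_boot all_order all_algebra all_fingroup.
From mathcomp Require Import zify.

(* Removing the last letter v^[a] of a colored permutation of size n+1 and
   standardizing the rest lowers inv_c by an amount [last_weight v a] that
   depends only on v and a. As (v, a) varies, this amount takes each value in
   {0, ..., c(n+1)-1} exactly once: a = 0 gives 0, ..., n and a > 0 gives the
   remaining values. Hence i_c(n+1, k) is the sum of the i_c(n, k - j) over
   0 <= j < c(n+1), and subtracting the same identity for k - 1 telescopes. *)

Set Implicit Arguments.
Unset Strict Implicit.
Unset Printing Implicit Defensive.

Import GRing.Theory Num.Theory.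
Local Open Scope ring_scope.

Section LastLetter.
Local Open Scope nat_scope.
Variables c n : nat.
Implicit Types (v : 'I_n.+1) (a : 'I_c) (s : colored_perm c n).

Lemma card_set_sum (T : finType) (P : pred T) : #|[set x | P x]| = \sum_x P x.
Proof. by rewrite -sum1dep_card big_mkcond; apply: eq_bigr => x _; case: (P x). Qed.

(** Split by whether the second index is [ord_max]; the first never is, and [lift ord_max] leaves
    values unchanged. This serves both [inv] and [colored_noninv]. *)
Lemma card_ltn_pairs_recr (Q : rel 'I_n.+1) :
  #|[set ij : 'I_n.+1 * 'I_n.+1 | (ij.1 < ij.2) && Q ij.1 ij.2]| =
  #|[set ij : 'I_n * 'I_n |
      (ij.1 < ij.2) && Q (lift ord_max ij.1) (lift ord_max ij.2)]| +
  \sum_(i < n) Q (lift ord_max i) ord_max.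
Proof.
have bump_max (i : 'I_n) : bump n i = i := lift_max i.
rewrite !card_set_sum.
rewrite -(pair_bigA _ (fun i j : 'I_n.+1 => nat_of_bool ((i < j) && Q i j))).
rewrite -(pair_bigA _ (fun i j : 'I_n => nat_of_bool
  ((i < j) && Q (lift ord_max i) (lift ord_max j)))) /=.
rewrite (bigD1_ord ord_max) //= big1 ?add0n => [|j _]; last first.
  by rewrite ltnNge -ltnS ltn_ord.
rewrite -big_split; apply: eq_bigr => i _ /=.
rewrite (bigD1_ord ord_max) //= addnC; congr (_ + _).
  by apply: eq_bigr => j _; rewrite !bump_max.
by rewrite bump_max ltn_ord.
Qed.

Lemma sum_ltn_lift v : \sum_(i < n) (v < lift v i) = n - v.
Proof.
transitivity (\sum_(i < n | v <= i) 1).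
  rewrite [RHS]big_mkcond; apply: eq_bigr => i _ /=; rewrite /bump.
  by case: (leqP v i) => H; lia.
rewrite -(big_mkord (fun i => v <= i) (fun=> 1)) /=.
by rewrite -(big_nat_widenl v 0 n predT) // sum_nat_const_nat muln1.
Qed.

Lemma sum_lift_ltn v : \sum_(i < n) (lift v i < v) = v.
Proof.
apply/eqP; rewrite -(eqn_add2l (n - v)) -{1}sum_ltn_lift -big_split /=.
rewrite (eq_bigr (fun=> 1)) => [|i _]; last first.
  by have := neq_bump v i; case: ltngtP.
by rewrite sum1_card card_ord subnK // -ltnS.
Qed.

Lemma ltn_lift v (i j : 'I_n) : (lift v i < lift v j) = (i < j).
Proof. by rewrite /= !ltnNge leq_bump2. Qed.

(** Inverse of deleting the last letter and standardizing: the old letters are relabelled by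
    [lift v], which skips [v] and keeps their order. *)
Definition add_last (x : ('I_n.+1 * 'I_c) * colored_perm c n) :
    colored_perm c n.+1 :=
  (lift_perm ord_max x.1.1 x.2.1,
   [ffun i => if unlift ord_max i is Some j then x.2.2 j else x.1.2]).

Lemma add_last_inj : injective add_last.
Proof.
move=> [[v a] [p f]] [[w b] [q g]] [] /= /permP Ep /ffunP Ef.
have Ev : v = w by have := Ep ord_max; rewrite !lift_perm_id.
have Ea : a = b by have := Ef ord_max; rewrite !ffunE unlift_none.
subst w b; congr (_, (_, _)).
  apply/permP => i; apply: (@lift_inj _ v).
  by have := Ep (lift ord_max i); rewrite !lift_perm_lift.
by apply/ffunP => i; have := Ef (lift ord_max i); rewrite !ffunE liftK.
Qed.

Lemma add_last_bij : bijective add_last.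
Proof.
apply: (inj_card_bij add_last_inj).
rewrite !card_prod !card_ffun !card_ord !card_Sn factS expnS.
by rewrite mulnACA.
Qed.

(** Of the earlier letters, [n - v] exceed [v] and form inversions with it; the other [v] are
    smaller and each cost [c] when [a] is nonzero. *)
Definition last_weight v a : nat := n - v + a + c * (v * (a != 0 :> nat)).

Lemma inv_lift_perm v (p : 'S_n) :
  Defs.inv (lift_perm ord_max v p) = Defs.inv p + (n - v).
Proof.
set p' := lift_perm _ _ _.
apply: etrans (card_ltn_pairs_recr (fun i j => p' j < p' i)) _.
congr (_ + _).
  by apply: eq_card => ij; rewrite !inE !lift_perm_lift ltn_lift.
(* Reindexing by [p] passes from a count over letters to a count over positions. *)
rewrite -(sum_ltn_lift v) [RHS](reindex_inj (@perm_inj _ p)).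
by apply: eq_bigr => i _; rewrite lift_perm_lift lift_perm_id.
Qed.

Lemma col_add_last v a s : Defs.col (add_last (v, a, s)) = Defs.col s + a.
Proof.
rewrite /Defs.col (bigD1_ord ord_max) //= ffunE unlift_none addnC.
by congr (_ + _); apply: eq_bigr => i _; rewrite ffunE liftK.
Qed.

Definition colored_noninv m (s : colored_perm c m) : nat :=
  #|[set ij : 'I_m * 'I_m |
      [&& ij.1 < ij.2, s.1 ij.1 < s.1 ij.2 & s.2 ij.2 != 0 :> nat]]|.

Lemma colored_noninv_add_last v a s :
  colored_noninv (add_last (v, a, s)) =
  colored_noninv s + v * (a != 0 :> nat).
Proof.
case: s => p f; set s' := add_last _.
apply: etrans (card_ltn_pairs_recr
  (fun i j => (s'.1 i < s'.1 j) && (s'.2 j != 0 :> nat))) _.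
congr (_ + _).
  by apply: eq_card => ij; rewrite !inE !lift_perm_lift ltn_lift ffunE liftK.
rewrite -[X in X * _](sum_lift_ltn v) big_distrl [RHS](reindex_inj (@perm_inj _ p)).
apply: eq_bigr => i _.
by rewrite lift_perm_lift lift_perm_id ffunE unlift_none -mulnb.
Qed.

Lemma inv_c_add_last v a s :
  inv_c (add_last (v, a, s)) = inv_c s + last_weight v a.
Proof.
rewrite /inv_c -!/(colored_noninv _) colored_noninv_add_last col_add_last.
by rewrite inv_lift_perm /last_weight mulnDr /=; lia.
Qed.

(** For [a > 0] the weight is n + a + (c-1)v, largest at a = c-1, v = n, where it equals c(n+1) -
    1. *)
Lemma last_weight_lt v a : last_weight v a < c * n.+1.
Proof.
rewrite /last_weight; have := ltn_ord v; have := ltn_ord a.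
by case: eqP => ? ? ?; nia.
Qed.

Definition last_weight_ord (x : 'I_n.+1 * 'I_c) : 'I_(c * n.+1) :=
  Ordinal (last_weight_lt x.1 x.2).

Lemma last_weight_ord_bij : bijective last_weight_ord.
Proof.
apply: inj_card_bij; last by rewrite card_prod !card_ord mulnC.
move=> [v a] [w b] [] /=; rewrite /last_weight.
have := ltn_ord v; have := ltn_ord a; have := ltn_ord w; have := ltn_ord b.
move=> hb hw ha hv E.
suff [Ev Ea] : v = w :> nat /\ a = b :> nat by congr (_, _); apply: val_inj.
move: E; case: (eqVneq (a : nat) 0) => ?; case: (eqVneq (b : nat) 0) => ? /= E;
  (* When both colors are nonzero they differ by at most c-2, while distinct letters shift the
     weight by at least c-1. *)
  have [?|[?|?]] : (v = w :> nat) \/ (v < w \/ w < v) by lia.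
all: split; nia.
Qed.

End LastLetter.

Lemma i_c_sum (c n : nat) (k : int) :
  i_c c n k = (\sum_(s : colored_perm c n) (Posz (inv_c s) == k))%N.
Proof. exact: card_set_sum. Qed.

(** Since [k] is an integer, terms with [j > k] vanish by themselves, so the range of [j] is the
    same for every [k]. *)
Lemma i_c_recr (c n : nat) (k : int) :
  i_c c n.+1 k = (\sum_(j < c * n.+1) i_c c n (k - Posz j))%N.
Proof.
rewrite i_c_sum (reindex _ (onW_bij _ (add_last_bij c n))) /=.
rewrite (reindex _ (onW_bij _ (last_weight_ord_bij c n))) /=.
under [RHS]eq_bigr => x _ do rewrite i_c_sum.
rewrite pair_bigA; apply: eq_bigr => -[[v a] s] _ /=.
by rewrite inv_c_add_last PoszD -subr_eq opprK.
Qed.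

Theorem theorem3p3 (n c : nat) (k : int)
  (hn : (1 < n)%N) (hc : (1 <= c)%N)
  (hk0 : 0 <= k) (hk : k <= Posz ((c - 1) * n + c * 'C(n, 2))%N) :
  (i_c c n k)%:Z =
  (i_c c n (k - 1))%:Z + (i_c c (n - 1) k)%:Z
    - (i_c c (n - 1) (k - Posz (c * n)))%:Z.
Proof.
case: n hn hk => // n _ _; rewrite subn1 /= !i_c_recr.
have : (0 < c * n.+1)%N by rewrite muln_gt0 hc.
case: (c * n.+1)%N => // m _.
(* Here [m.+1] stands for c(n+1). Peel [j = 0] off the sum for [k] and [j = m] off the sum for
   [k - 1]; the remaining sums agree after shifting [j] by one. *)
rewrite big_ord_recl [in RHS]big_ord_recr /= subr0.
have -> : k - 1 - Posz m = k - Posz m.+1 by lia.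
under eq_bigr => j _ do
  (have -> : k - Posz (bump 0 j) = k - 1 - Posz j by rewrite /bump; lia).
lia.
Qed.
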